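(* Let $n\ge2$ and let $\mu(dx)=\mu_r(d\rho)\,\mu_a(d\theta)$ be a nearly radial probability measure on $\mathbb R^n$. Then, for all $t>0$, $$\beta^{WP}_\mu(t)\ \le\ \max\left(\beta^{WP}_{\mu_r}(t/2)\,,\ \mu_r(\rho^2)\,\beta^{WP}_{\mu_a}(t/2)\right).$$
   Context: Write $x=\rho\theta$ with $\rho=|x|\ge0$, $\theta\in\mathbb S^{n-1}$. $\mu$ is nearly radial if $\mu(dx)=\mu_r(d\rho)\,\mu_a(d\theta)$, i.e. $\mu$ is the image under $(\rho,\theta)\mapsto\rho\theta$ of $\mu_r\otimes\mu_a$, where $\mu_r$ is a probability measure on $\mathbb R^+$ with density proportional to $\rho^{n-1}e^{-V_r(\rho)}$ and $\mu_a$ is a probability measure on $\mathbb S^{n-1}$ with density proportional to $e^{-V_a(\theta)}$ with respect to the uniform measure. $\mu_r(\rho^2)=\int\rho^2\,\mu_r(d\rho)$. For a probability measure $\nu$, $\beta^{WP}_\nu(t)$, $t>0$, denotes the (smallest) non-increasing function, possibly infinite, such that the weak Poincaré inequality $$\nu(f^2)-\nu(f)^2\le\beta^{WP}_\nu(t)\,\nu(|\nabla f|^2)+t\,\mathrm{Osc}^2(f)$$ holds for all $t>0$ and all smooth $f$, where $\mathrm{Osc}(f)=\sup f-\inf f$ and $\nu(f)=\int f\,d\nu$. For $\mu_r$, $|\nabla f|=|f'|$; for $\mu_a$, $\nabla$ is the Riemannian (tangential) gradient on $\mathbb S^{n-1}$. *)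

(* Defs.v *)
From HB Require Import structures.
From mathcomp Require Import all_boot all_order all_algebra.
From mathcomp Require Import all_classical all_reals all_analysis.

Set Implicit Arguments.
Unset Strict Implicit.
Unset Printing Implicit Defensive.

Import Order.TTheory GRing.Theory Num.Theory.
Import numFieldNormedType.Exports.

Local Open Scope classical_set_scope.
Local Open Scope ring_scope.

Section WeakPoincare.
Local Open Scope ereal_scope.
Context {d : measure_display} {T : measurableType d} {R : realType}.

Definition Osc (D : set T) (f : T -> R) : \bar R :=
  ereal_sup [set (f x)%:E | x in D] - ereal_inf [set (f x)%:E | x in D].

(* In the three definitions below, [nu] is carried by [D], [smooth] is the set
   of test functions, of which only the values on [D] matter, and [gradsq f x]
   is the value of |grad f|^2 at the point x of [D]. *)
Definition weak_poincare (nu : probability T R) (D : set T)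
    (smooth : set (T -> R)) (gradsq : (T -> R) -> T -> R)
    (b : R -> \bar R) : Prop :=
  forall (t : R) (f : T -> R), (0 < t)%R -> smooth f ->
    \int[nu]_(x in D) (f x ^+ 2)%:E - (\int[nu]_(x in D) (f x)%:E) ^+ 2
      <= b t * \int[nu]_(x in D) (gradsq f x)%:E + t%:E * Osc D f ^+ 2.

Definition wp_admissible (nu : probability T R) (D : set T)
    (smooth : set (T -> R)) (gradsq : (T -> R) -> T -> R)
    : set (R -> \bar R) :=
  [set b | [/\ forall t : R, (0 < t)%R -> 0 <= b t,
               forall s t : R, (0 < s)%R -> (s <= t)%R -> b t <= b s
             & weak_poincare nu D smooth gradsq b]].

(* The smallest admissible function is the pointwise infimum of the admissible
   ones; it is meaningful at t > 0 only. *)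
Definition betaWP (nu : probability T R) (D : set T)
    (smooth : set (T -> R)) (gradsq : (T -> R) -> T -> R) (t : R) : \bar R :=
  ereal_inf [set b t | b in wp_admissible nu D smooth gradsq].

(* As [nu] is a probability measure, c is the normalizing constant. *)
Definition density_proportional_to (lambda : {measure set T -> \bar R})
    (D : set T) (w : T -> R) (nu : probability T R) : Prop :=
  measurable_fun D w /\
  exists2 c : R, (0 < c)%R & forall A : set T, measurable A ->
    nu A = \int[lambda]_(x in A `&` D) (c * w x)%:E.

End WeakPoincare.

(* R^n with its Borel sigma-algebra. *)
Definition Rn (R : realType) (n : nat) : measurableType _ :=
  g_sigma_algebraType (@open 'rV[R]_n).

Section Euclidean.
Context {R : realType} {n : nat}.

(* The library norm on row vectors is the sup norm, so Euclidean lengths are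
   expressed with the scalar product. *)
Definition dotv (u v : 'rV[R]_n) : R := \sum_(i < n) u ord0 i * v ord0 i.

Definition sphere : set 'rV[R]_n := [set x | dotv x x = 1].

Definition partial (i : 'I_n) (f : 'rV[R]_n -> R) : 'rV[R]_n -> R :=
  fun x => 'D_(delta_mx ord0 i) f x.

Definition partials (s : seq 'I_n) (f : 'rV[R]_n -> R) : 'rV[R]_n -> R :=
  foldr partial f s.

(* C^infinity on U, which is meant to be open: partial derivatives of all
   orders exist and are continuous at every point of U. *)
Definition smooth_on (U : set 'rV[R]_n) (f : 'rV[R]_n -> R) : Prop :=
  forall (s : seq 'I_n) (x : 'rV[R]_n), U x ->
    {for x, continuous (partials s f)} /\
    forall i : 'I_n, derivable (partials s f) x (delta_mx ord0 i).

Definition grad (f : 'rV[R]_n -> R) (x : 'rV[R]_n) : 'rV[R]_n :=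
  \row_i partial i f x.

(* Smooth functions on the sphere, as restrictions of functions that are
   smooth on a neighborhood of it. *)
Definition smooth_sphere : set ('rV[R]_n -> R) :=
  [set f | exists U : set 'rV[R]_n, [/\ open U, sphere `<=` U & smooth_on U f]].

(* Riemannian gradient at a point x of the sphere: orthogonal projection of the
   Euclidean gradient onto the tangent space; it depends only on f restricted
   to the sphere. *)
Definition sphere_grad (f : 'rV[R]_n -> R) (x : 'rV[R]_n) : 'rV[R]_n :=
  grad f x - dotv (grad f x) x *: x.

(* The uniform measure of the sphere, as a measure on R^n: the rotation
   invariant probability measure. *)
Definition uniform_sphere (sigma : probability (Rn R n) R) : Prop :=
  sigma sphere = 1%E /\
  forall O : 'M[R]_n, O *m O^T = 1%:M ->
    forall A : set (Rn R n), measurable A ->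
      sigma [set x | A ((x : 'rV[R]_n) *m O)] = sigma A.

Definition polar (p : measurableTypeR R * Rn R n) : Rn R n :=
  (p.1 : R) *: (p.2 : 'rV[R]_n).

End Euclidean.

Section NearlyRadial.
Context {R : realType}.

Definition Rplus : set R := `[0, +oo[.

(* Smooth functions on the closed half-line R^+ are the restrictions of smooth
   functions on R. *)
Definition smooth_line : set (R -> R) :=
  [set f | forall (k : nat) (r : R), derivable (derive1n k f) r 1].

Definition nearly_radial (n : nat) (sigma : probability (Rn R n) R)
    (Vr : R -> R) (Va : 'rV[R]_n -> R)
    (mu : probability (Rn R n) R)
    (mur : probability (measurableTypeR R) R)
    (mua : probability (Rn R n) R) : Prop :=
  [/\ density_proportional_to lebesgue_measure Rplus
        (fun r : R => r ^+ n.-1 * expR (- Vr r)) mur,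
      density_proportional_to sigma sphere (fun x => expR (- Va x)) mua
    & forall A : set (Rn R n), measurable A ->
        mu A = pushforward (mur \x mua)%E polar A].

Definition betaWP_Rn (n : nat) (mu : probability (Rn R n) R) : R -> \bar R :=
  betaWP mu setT (smooth_on setT) (fun f x => dotv (grad f x) (grad f x)).

Definition betaWP_radial (mur : probability (measurableTypeR R) R)
    : R -> \bar R :=
  betaWP mur Rplus smooth_line (fun f r => derive1 f r ^+ 2).

Definition betaWP_sphere (n : nat) (mua : probability (Rn R n) R)
    : R -> \bar R :=
  betaWP mua sphere smooth_sphere
    (fun f x => dotv (sphere_grad f x) (sphere_grad f x)).

Definition second_moment (mur : probability (measurableTypeR R) R) : \bar R :=
  (\int[mur]_(r in Rplus) (r ^+ 2)%:E)%E.

End NearlyRadial.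

(* Main.v *)
Require Import Defs.
From mathcomp Require Import all_boot all_order all_algebra.
From mathcomp Require Import all_classical all_reals all_analysis.
From mathcomp Require Import measurable_realfun.
From mathcomp Require Import ring lra.

Set Implicit Arguments.
Unset Strict Implicit.
Unset Printing Implicit Defensive.

Import Order.TTheory GRing.Theory Num.Theory.
Import numFieldNormedType.Exports.

Local Open Scope classical_set_scope.
Local Open Scope ring_scope.

(** The variance of a test function [f] under the image of [mur \x mua] by
    [(r, x) |-> r *: x] splits, conditionally on the direction, into
    - the average over the directions [x] of the variance under [mur] of the
      ray [r |-> f (r *: x)], and
    - the variance under [mua] of the radial mean
      [F x = \int f (r *: x) mur(dr)].
    For a unit vector [x] the squared gradient of [f] at [r *: x] is the square
    of the derivative of the ray plus the squared norm of the part of the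
    gradient that is tangent to the sphere at [x] ([dotv_grad_split]). The weak
    Poincare inequality for [mur], applied to each ray with parameter [t / 2]
    and integrated over [x], controls the first term by the radial energy
    ([radial_part]). The gradient of [F] on the sphere is the integral of [r]
    times the tangential gradient at [r *: x], so by Cauchy-Schwarz its squared
    norm is at most the second moment of [mur] times the integral of the squared
    tangential gradient; the inequality for [mua] then controls the second term
    ([angular_part]). All the oscillations involved are at most that of [f], and
    the two halves of [t] add up.

    Two points need care. First, [F] may fail to be differentiable, because [f]
    is an arbitrary smooth function whose derivatives can grow at infinity. The
    radial mean is therefore truncated to [r] in [`[0, k]]: the truncated mean
    is smooth by differentiation under the integral over a compact interval
    ([smooth_radial_average]), it satisfies the same energy and oscillation
    bounds ([truncated_energy], [truncation_oscillation]), and it converges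
    uniformly to [F] when [f] is bounded. If [f] is unbounded its oscillation is
    infinite and there is nothing to prove.

    Second, the constants are infima in the extended reals, where zero times
    infinity is zero. On the sphere, smooth functions have finite energy by
    compactness, so the infimum is itself an admissible constant as soon as one
    admissible function exists; if none exists, the right-hand side of the
    bound is infinite because the second moment of [mur] is positive. On the
    half-line the energy can be infinite, so each admissible function is kept
    and the infimum is taken only at the end. *)

(** * Derivatives of smooth functions along lines *)

Section DirectionalDerivatives.
Context {R : realType} {V : normedModType R}.

(** Difference quotients in epsilon-delta form, which is the form in which
    derivatives are computed below. *)
Lemma is_deriveP (f : V -> R) (x v : V) (l : R) :
  is_derive x v f l <->
  forall e, 0 < e -> exists2 d, 0 < d & forall h, h != 0 -> `|h| < d ->
    `|h^-1 * (f (x + h *: v) - f x) - l| < e.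
Proof.
have E h : h^-1 *: ((f \o shift x) (h *: v) - f x) =
    h^-1 * (f (x + h *: v) - f x) by rewrite /= (addrC x).
split=> [[df dl] e e0|fl].
  have : (fun h => h^-1 *: ((f \o shift x) (h *: v) - f x)) @ 0^' --> l.
    by rewrite -dl; exact: df.
  move=> /cvgrPdist_lt /(_ e e0) [d /= d0 H]; exists d => // h h0 hd.
  rewrite distrC -E; apply: H => //=; by rewrite sub0r normrN.
have C : (fun h => h^-1 *: ((f \o shift x) (h *: v) - f x)) @ 0^' --> l.
  apply/cvgrPdist_lt => e e0; have [d d0 H] := fl _ e0; exists d => // h /=.
  by rewrite sub0r normrN distrC E => hd h0; apply: H.
by split; [apply/cvg_ex; exists l | apply: cvg_lim].
Qed.

End DirectionalDerivatives.

Section Lines.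
Context {R : realType} {V : normedModType R}.

Lemma is_derive_line (f : V -> R) (x v : V) (t l : R) :
  is_derive (x + t *: v) v f l -> is_derive t 1 (fun s => f (x + s *: v)) l.
Proof.
move=> /is_deriveP H; apply/is_deriveP => e /H [d d0 Hd].
exists d => // h h0 hd; have := Hd h h0 hd.
by rewrite -addrA -scalerDl [h *: _]mulr1.
Qed.

Lemma MVT_line (f : V -> R) (v : V) (df : V -> R) :
  (forall x, is_derive x v f (df x)) ->
  forall x c, exists2 s, `|s| <= `|c| & f (x + c *: v) - f x = c * df (x + s
    *: v).
Proof.
move=> H x c; pose phi (s : R) := f (x + s *: v).
have D (s : R) : is_derive s 1 phi (df (x + s *: v)) by exact: is_derive_line.
have C a b : {within `[a, b], continuous phi}.
  by apply: derivable_within_continuous => s _; by have [] := D s.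
have [c0|c0] := leP 0 c.
  have [s /[!in_itv]/= /andP[s0 sc]] :=
    @MVT_segment _ phi (fun s => df (x + s *: v)) 0 c c0 (fun s _ =>
      D s) (C _ _).
  rewrite /phi scale0r addr0 subr0 => E; exists s; first by rewrite !ger0_norm.
  by rewrite E mulrC.
have [s /[!in_itv]/= /andP[cs s0]] := @MVT_segment _ phi
  (fun s => df (x + s *: v)) c 0 (ltW c0) (fun s _ => D s) (C _ _).
rewrite /phi scale0r addr0 sub0r => E; exists s.
  by rewrite !ler0_norm ?lerN2// ltW.
by rewrite -opprB E mulrN opprK mulrC.
Qed.

Lemma continuous_eps (g : V -> R) (x : V) :
  {for x, continuous g} <-> forall e, 0 < e -> exists2 d, 0 < d &
    forall y, `|y| < d -> `|g (x + y) - g x| < e.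
Proof.
split=> [/cvgrPdist_lt H e /H /nbhs_ballP[d /= d0 Hd]|H].
  exists d => // y yd; rewrite distrC; apply: Hd.
  by rewrite -ball_normE/= opprD addNKr normrN.
apply/cvgrPdist_lt => e /H [d d0 Hd]; apply/nbhs_ballP; exists d => //= y.
rewrite -ball_normE/= => xy; rewrite distrC.
have -> : y = x + (y - x) by rewrite addrC subrK.
by apply: Hd; rewrite distrC.
Qed.

(** Only one of the two directions needs a derivative at every point: the
    increment in direction [w] is taken from a base point that moves with the
    increment in direction [v], and the mean value theorem together with
    continuity of [dw] at [x] absorbs this displacement. *)
Lemma is_deriveDr (f : V -> R) (x v w : V) (l c : R) (dw : V -> R) :
  is_derive x v f l -> (forall y, is_derive y w f (dw y)) ->
  {for x, continuous dw} ->
  is_derive x (v + c *: w) f (l + c * dw x).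
Proof.
move=> /is_deriveP dv Hw /continuous_eps cw; apply/is_deriveP => e e0.
have e20 : 0 < e / 2 by rewrite divr_gt0.
have ec0 : 0 < e / 2 / (`|c| + 1) by rewrite divr_gt0// ltr_wpDl.
have [d1 d10 H1] := dv _ e20; have [d2 d20 H2] := cw _ ec0.
pose K := `|v| + `|c| * `|w| + 1.
have K0 : 0 < K by rewrite ltr_wpDl// addr_ge0// mulr_ge0.
exists (Num.min d1 (d2 / K)); first by rewrite lt_min d10 divr_gt0.
move=> h h0; rewrite lt_min => /andP[hd1 hd2].
have [s sc E] := MVT_line Hw (x + h *: v) (h * c).
have -> : x + h *: (v + c *: w) = (x + h *: v) + (h * c) *: w.
  by rewrite scalerDr addrA scalerA.
have -> : h^-1 * (f (x + h *: v + (h * c) *: w) - f x) - (l + c * dw x) =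
    (h^-1 * (f (x + h *: v) - f x) - l) +
    c * (dw (x + (h *: v + s *: w)) - dw x).
  rewrite -(subrK (f (x + h *: v)) (f (_ + _ *: w))) E addrA.
  by field.
apply: le_lt_trans (ler_normD _ _) _; rewrite (splitr e) ltr_leD//.
  exact: H1.
rewrite normrM; have : `|dw (x + (h *: v + s *: w)) - dw x| < e / 2 / (`|c| +
  1).
  apply: H2; apply: le_lt_trans (ler_normD _ _) _; rewrite !normrZ.
  apply: (@le_lt_trans _ _ (`|h| * K)); last by rewrite -ltr_pdivlMr.
  rewrite /K -addrA mulrDr lerD2l mulrDr mulr1 ler_wpDr// mulrA.
  by rewrite ler_wpM2r// -normrM.
rewrite ltr_pdivlMr ?ltr_wpDl// => /ltW; apply: le_trans.
by rewrite mulrC ler_wpM2l// lerDl.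
Qed.

End Lines.

Section SmoothFunctions.
Context {R : realType} {n : nat}.
Implicit Types (f g : 'rV[R]_n -> R) (x v : 'rV[R]_n).

Local Notation smooth f := (smooth_on (@setT 'rV[R]_n) f).
Local Notation e_ i := (delta_mx ord0 i : 'rV[R]_n).

Lemma smooth_continuous f : smooth f -> continuous f.
Proof. by move=> sf x; have [] := sf [::] x I. Qed.

Lemma smooth_is_partial f x i :
  smooth f -> is_derive x (e_ i) f (partial i f x).
Proof. by move=> sf; apply: derivableP; have [_] := sf [::] x I; apply. Qed.

Lemma partials_partial s i f :
  partials s (partial i f) = partials (rcons s i) f.
Proof. by rewrite /partials foldr_rcons. Qed.

Lemma smooth_partial f i : smooth f -> smooth (partial i f).
Proof. by move=> sf s x _; rewrite partials_partial; exact: sf. Qed.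

Lemma smooth_partials f s : smooth f -> smooth (partials s f).
Proof. by elim: s => [//|i s IH] sf; apply: smooth_partial; exact: IH. Qed.

Definition along v f x : R := \sum_i v ord0 i * partial i f x.

(** Adding the coordinate directions one at a time shows that directional
    derivatives of a smooth function depend linearly on the direction; this is
    the chain rule along rays. *)
Lemma smooth_is_derive f x v : smooth f -> is_derive x v f (along v f x).
Proof.
move=> sf; rewrite [v in is_derive _ v](row_sum_delta v) /along.
have H (s : seq 'I_n) : is_derive x (\sum_(i <- s) v ord0 i *: e_ i) f
    (\sum_(i <- s) v ord0 i * partial i f x).
  elim: s => [|i s IH]; first by rewrite !big_nil; exact: is_derive0.
  rewrite !big_cons addrC [X in is_derive _ _ _ X]addrC.
  apply: is_deriveDr => //; first by move=> y; exact: smooth_is_partial.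
  by apply: smooth_continuous; exact: smooth_partial.
exact: H.
Qed.

Lemma smooth_lincomb (c : 'I_n -> R) (g : 'I_n -> 'rV[R]_n -> R) :
  (forall i, smooth (g i)) -> smooth (fun x => \sum_i c i * g i x).
Proof.
move=> sg s.
have -> : partials s (fun x => \sum_i c i * g i x) =
    fun x => \sum_i c i * partials s (g i) x.
  elim: s => //= j s ->; apply/funext => x; rewrite /partial.
  have /(_ x)[_ <-] : forall y, is_derive y (e_ j)
     (\sum_i (c i \*: partials s (g i))) (\sum_i c i *: partial j (partials s
       (g i)) y).
    move=> y; apply: is_derive_sum => i; apply: is_deriveZ.
    by apply: smooth_is_partial; exact: smooth_partials.
  by congr (derive _ _ _); apply/funext => y; rewrite fct_sumE.
move=> x _; split=> [|j].
  have C : continuous (fun y => \sum_i c i * partials s (g i) y).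
    apply: (continuous_big add_continuous) => i _ y.
    have [cy _] := sg i s y I; exact: (cvgMl_tmp cy).
  exact: C.
have -> : (fun x => \sum_i c i * partials s (g i) x) =
  \sum_i (c i \*: partials s (g i)) by apply/funext => y; rewrite fct_sumE.
apply: derivable_sum => i; apply: derivableZ.
by have [_] := sg i s x I; apply.
Qed.

Lemma smooth_along v f : smooth f -> smooth (along v f).
Proof.
by move=> sf; apply: smooth_lincomb => i; exact: smooth_partial.
Qed.

Definition ray f v : R -> R := fun r => f (r *: v).

Lemma is_derive_ray f v (r : R) : smooth f ->
  is_derive r 1 (ray f v) (ray (along v f) v r).
Proof.
move=> sf; have -> : ray f v = fun r => f (0 + r *: v).
  by apply/funext => s; rewrite add0r.
apply: is_derive_line; rewrite add0r; exact: smooth_is_derive.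
Qed.

Lemma derive1_ray f v : smooth f -> derive1 (ray f v) = ray (along v f) v.
Proof.
by move=> sf; apply/funext => r; rewrite derive1E;
  have [] := is_derive_ray v r sf.
Qed.

(** Differentiating a ray of [f] gives the ray of [along v f], which is again
    smooth, so all derivatives exist by induction. *)
Lemma smooth_ray f v : smooth f -> smooth_line (ray f v).
Proof.
move=> sf k; have [g sg ->] : exists2 g, smooth g & derive1n k (ray f v) = ray
  g v.
  elim: k => [|k [g sg E]]; first by exists f.
  by exists (along v g); [exact: smooth_along|rewrite derive1nS E derive1_ray].
by move=> r; have [] := is_derive_ray v r sg.
Qed.

Lemma dotv_ge0 v : 0 <= dotv v v.
Proof. by apply: sumr_ge0 => i _; rewrite -expr2 sqr_ge0. Qed.

Lemma along_dotv v f x : along v f x = dotv v (grad f x).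
Proof. by apply: eq_bigr => i _; rewrite mxE. Qed.

Lemma along_delta i f : along (e_ i) f = partial i f.
Proof.
apply/funext => x; rewrite /along (bigD1 i)//= big1 ?addr0 => [|j ji].
  by rewrite mxE !eqxx mul1r.
by rewrite mxE (negbTE ji) andbF mul0r.
Qed.

(** The orthogonal projection of the [i]-th basis vector to the tangent space
    at a unit vector [x]. *)
Definition tangent x i : 'rV[R]_n := e_ i - x ord0 i *: x.

Lemma along_tangent f x y i :
  along (tangent x i) f y = partial i f y - x ord0 i * along x f y.
Proof.
rewrite -along_delta /along mulr_sumr -sumrB; apply: eq_bigr => j _.
by rewrite !mxE mulrBl mulrA.
Qed.

(** The coordinates of the tangential gradient are directional derivatives, so
    the rule for differentiating averages in a fixed direction applies. *)
Lemma sphere_grad_tangent f x :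
  dotv (sphere_grad f x) (sphere_grad f x) =
  \sum_i along (tangent x i) f x ^+ 2.
Proof.
apply: eq_bigr => i _; rewrite !mxE along_tangent along_dotv expr2.
suff -> : dotv x (grad f x) = dotv (grad f x) x by congr (_ * _); rewrite mulrC.
by apply: eq_bigr => j _; rewrite mulrC.
Qed.

(** Pythagoras: the derivatives along the vectors [tangent v i] are the
    coordinates of the component of the gradient orthogonal to [v]. *)
Lemma dotv_grad_split f v y : dotv v v = 1 ->
  dotv (grad f y) (grad f y) = along v f y ^+ 2 +
    \sum_i along (tangent v i) f y ^+ 2.
Proof.
move=> v1; under [in RHS]eq_bigr do rewrite along_tangent sqrrB.
set a := along v f _; rewrite /dotv.
under [in LHS]eq_bigr do rewrite !mxE -expr2.
rewrite big_split/= sumrB.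
have -> : \sum_i (v ord0 i * a) ^+ 2 = a ^+ 2.
  under eq_bigr do rewrite exprMn (expr2 (v _ _)).
  by rewrite -mulr_suml -/(dotv v v) v1 mul1r.
have -> : \sum_i partial i f y * (v ord0 i * a) *+ 2 = a ^+ 2 *+ 2.
  rewrite sumrMnl; congr (_ *+ _); rewrite expr2.
  transitivity (a * along v f y); last by [].
  by rewrite [in RHS]/along mulr_sumr; apply: eq_bigr => i _; ring.
by rewrite mulr2n; ring.
Qed.

End SmoothFunctions.

(** * Bounded functions under a probability measure *)

Section BoundedIntegrals.
Context d {T : measurableType d} {R : realType} (P : probability T R).
Implicit Types (D : set T) (g : T -> R).

Lemma bounded_integrable D g (M : R) : measurable D -> measurable_fun D g ->
  (forall x, D x -> `|g x| <= M) -> P.-integrable D (EFin \o g).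
Proof.
move=> mD mg gM; apply: measurable_bounded_integrable => //.
  by rewrite (le_lt_trans (probability_le1 P mD))// ltry.
exists M; split; first by rewrite num_real.
by move=> N MN x Dx /=; rewrite (le_trans (gM x Dx))// ltW.
Qed.

Lemma Rintegral_bound_measure D g (M : R) : measurable D ->
  measurable_fun D g ->
  (forall x, D x -> `|g x| <= M) ->
  `|\int[P]_(x in D) g x| <= M * fine (P D).
Proof.
move=> mD mg gM; have ig := bounded_integrable mD mg gM.
apply: (le_trans (le_normr_Rintegral mD ig)).
rewrite -Rintegral_cst//; apply: le_Rintegral => //.
  apply: (@bounded_integrable _ _ M) => //; first exact: measurableT_comp.
  by move=> x Dx /=; rewrite normr_id gM.
exact: finite_measure_integrable_cst.
Qed.

Lemma Rintegral_bound D g (M : R) : measurable D -> measurable_fun D g ->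
  0 <= M -> (forall x, D x -> `|g x| <= M) ->
  `|\int[P]_(x in D) g x| <= M.
Proof.
move=> mD mg M0 /(Rintegral_bound_measure mD mg); move/le_trans; apply.
rewrite ler_piMr// -lee_fin fineK ?fin_num_measure//.
exact: probability_le1.
Qed.

Lemma integrableB_EFin D g h : measurable D ->
  P.-integrable D (EFin \o g) -> P.-integrable D (EFin \o h) ->
  P.-integrable D (EFin \o (fun x => g x - h x)).
Proof. by move=> mD ig ih; exact: (integrableB mD ig ih). Qed.

Lemma integrableZ_EFin D g c : measurable D ->
  P.-integrable D (EFin \o g) -> P.-integrable D (EFin \o (fun x => c * g x)).
Proof. by move=> mD ig; exact: (integrableZl mD c ig). Qed.

End BoundedIntegrals.

Section CauchySchwarz.
Context d {T : measurableType d} {R : realType} (P : probability T R).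

(** The quadratic polynomial [r |-> \int (r u + v)^2] is nonnegative, hence its
    discriminant is nonpositive. *)
Lemma Rintegral_cauchy_schwarz (D : set T) (u v : T -> R) (A B : R) :
  measurable D -> measurable_fun D u -> measurable_fun D v ->
  (forall x, D x -> `|u x| <= A) -> (forall x, D x -> `|v x| <= B) ->
  (\int[P]_(x in D) (u x * v x)) ^+ 2 <=
    \int[P]_(x in D) (u x ^+ 2) * \int[P]_(x in D) (v x ^+ 2).
Proof.
move=> mD u_m v_m uA vB.
have prodI (f g : T -> R) (a b : R) : measurable_fun D f ->
  measurable_fun D g ->
    (forall x, D x -> `|f x| <= a) -> (forall x, D x -> `|g x| <= b) ->
    P.-integrable D (EFin \o (fun x => f x * g x)).
  move=> mf mg fa gb; apply: (@bounded_integrable _ _ _ P _ _ (a * b)) => //.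
    exact: measurable_funM.
  by move=> x Dx; rewrite normrM ler_pM ?fa ?gb.
have Iuv := prodI _ _ _ _ u_m v_m uA vB.
have Iuu : P.-integrable D (EFin \o (fun x => u x ^+ 2)).
  exact: (prodI _ _ _ _ u_m u_m uA uA).
have Ivv : P.-integrable D (EFin \o (fun x => v x ^+ 2)).
  exact: (prodI _ _ _ _ v_m v_m vB vB).
set a := \int[P]_(x in D) (u x ^+ 2); set c := \int[P]_(x in D) (v x ^+ 2).
set b := \int[P]_(x in D) (u x * v x).
have key r : 0 <= a * r ^+ 2 + 2 * b * r + c.
  have -> : a * r ^+ 2 + 2 * b * r + c =
      \int[P]_(x in D) (r ^+ 2 * u x ^+ 2 + 2 * r * (u x * v x) + v x ^+ 2).
    have IZ1 := integrableZ_EFin (r ^+ 2) mD Iuu.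
    have IZ2 := integrableZ_EFin (2 * r) mD Iuv.
    have ID : P.-integrable D
        (EFin \o (fun x => r ^+ 2 * u x ^+ 2 + 2 * r * (u x * v x))).
      exact: (integrableD mD IZ1 IZ2).
    rewrite !RintegralD// !RintegralZl// -/a -/b -/c; ring.
  apply: Rintegral_ge0 => x _.
  have -> : r ^+ 2 * u x ^+ 2 + 2 * r * (u x * v x) + v x ^+ 2 =
    (r * u x + v x) ^+ 2 by ring.
  exact: sqr_ge0.
have p0 r : 0 <= (Poly [:: c; 2 * b; a]).[r].
  by rewrite horner_Poly/=; have := key r; congr (0 <= _); ring.
have := @deg_le2_poly_ge0 R _ (size_Poly [:: c; 2 * b; a]) p0;
  rewrite !coef_Poly [_`_1]/= [_`_2]/= [_`_0]/=.
have -> : (2 * b) ^+ 2 - 4 * a * c = 4 * (b ^+ 2 - a * c) by ring.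
by rewrite pmulr_rle0// subr_le0.
Qed.

End CauchySchwarz.

(** * Averages along rays *)

Section UniformAlong.
Context {R : realType} {V : normedModType R}.

(** The tube lemma, with the compact segment spanned by [x] as fibre. *)
Lemma continuous_uniform_along (g : V -> R) (x : V) (k e : R) :
  continuous g -> 0 < e -> exists2 d, 0 < d &
    forall r z, 0 <= r <= k -> `|z| < d -> `|g (r *: x + z) - g (r *: x)| < e.
Proof.
move=> cg e0.
have H : \forall z \near (0 : V), `[0, k] `<=`
    (fun r : R => `|g (r *: x + z) - g (r *: x)| < e).
  apply: (proj1 (compact_near_coveringP _) (@segment_compact R 0 k)) => r _.
  have C : {for (r, 0 : V), continuous
      (fun p : R * V => g (p.1 *: x + p.2) - g (p.1 *: x))}.
    have C1 (p : R * V) : {for p, continuous (fun p : R * V => p.1 *: x)}.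
      by apply: cvgZr_tmp; exact: cvg_fst.
    apply: cvgB; apply: continuous_comp => //; try exact: cg.
    by apply: cvgD; [exact: C1|exact: cvg_snd].
  move: C => /cvgrPdist_lt /(_ e e0); apply: filterS => -[s z] /=.
  by rewrite addr0 subrr sub0r normrN.
move: H => /nbhs_ballP[d /= d0 H]; exists d => // r z rk zd; apply: H;
  last by rewrite /= in_itv.
by rewrite -ball_normE/= sub0r normrN.
Qed.

Lemma continuous_along (g : V -> R) (x : V) :
  continuous g -> continuous (fun r : R => g (r *: x)).
Proof.
move=> cg r; apply: continuous_comp; last exact: cg.
by apply: cvgZr_tmp; exact: cvg_id.
Qed.

Lemma continuous_bounded_along (g : V -> R) (x : V) (k : R) :
  continuous g -> exists2 M, 0 <= M & forall r, 0 <= r <= k ->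
    `|g (r *: x)| <= M.
Proof.
move=> cg; have C := @continuous_along g x cg.
have /compact_bounded[M [_ HM]] : compact ((fun r => g (r *: x)) @` `[0, k]).
  by apply: continuous_compact; [exact: continuous_subspaceT|exact:
    segment_compact].
exists (`|M| + 1) => [|r rk]; first by rewrite addr_ge0.
apply: HM; first by rewrite (le_lt_trans (ler_norm M))// ltrDl.
by exists r.
Qed.

End UniformAlong.

Section TruncatedRadialAverages.
Context {R : realType} {n : nat}.
Variables (P : probability (measurableTypeR R) R) (k : R).
Implicit Types (g : 'rV[R]_n -> R) (x : 'rV[R]_n) (m : nat).

Local Notation smooth f := (smooth_on (@setT 'rV[R]_n) f).
Local Notation e_ i := (delta_mx ord0 i : 'rV[R]_n).
Local Notation K := (`[0, k]%classic : set R).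

(** The power of [r] makes the family stable under differentiation in [x]. *)
Definition radial_average m g x : R := \int[P]_(r in K) (r ^+ m * g (r *: x)).

Lemma measurable_moment_along m g x : continuous g ->
  measurable_fun K (fun r : R => r ^+ m * g (r *: x)).
Proof.
move=> cg; apply: measurable_funM.
  exact: exprn_measurable.
apply: measurable_funTS; apply: continuous_measurable_fun.
exact: continuous_along.
Qed.

Lemma integrable_moment_along m g x : continuous g ->
  P.-integrable K (EFin \o (fun r : R => r ^+ m * g (r *: x))).
Proof.
move=> cg; have [M M0 HM] := continuous_bounded_along x k cg.
apply: (@bounded_integrable _ _ _ P _ _ (k ^+ m * M)) => //.
  exact: measurable_moment_along.
move=> r /=; rewrite in_itv/= => /[dup] rk /andP[r0 rlek].
by rewrite normrM normrX ger0_norm// ler_pM ?exprn_ge0// ?HM// lerXn2r//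
  nnegrE (le_trans r0).
Qed.

Lemma radial_average_continuous m g : continuous g ->
  continuous (radial_average m g).
Proof.
move=> cg x; apply/continuous_eps => e e0.
pose c := e / 2 / (`|k| ^+ m + 1).
have c0 : 0 < c by rewrite !divr_gt0// ltr_wpDl// exprn_ge0.
have [d d0 Hd] := continuous_uniform_along x k cg c0.
exists (d / (`|k| + 1)) => [|y yd]; first by rewrite divr_gt0// ltr_wpDl.
rewrite /radial_average -RintegralB//; [|exact: integrable_moment_along..].
apply: (@le_lt_trans _ _ (e / 2)); last by rewrite ltr_pdivrMr// ltr_pMr//
  ltr1n.
apply: Rintegral_bound => //; last 1 first.
- move=> r /=; rewrite in_itv/= => rk; have /andP[r0 rlek] := rk.
  have rK : `|r| <= `|k| by rewrite !ger0_norm// (le_trans r0).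
  have lt : `|g (r *: x + r *: y) - g (r *: x)| < c.
    apply: Hd => //; rewrite normrZ; move: yd; rewrite ltr_pdivlMr ?ltr_wpDl//.
    by apply: le_lt_trans; rewrite mulrC ler_wpM2l// (le_trans rK)// lerDl.
  rewrite -mulrBr scalerDr normrM normrX.
  move: lt; rewrite /c ltr_pdivlMr ?ltr_wpDl ?exprn_ge0// => /ltW;
    apply: le_trans.
  rewrite mulrC ler_wpM2l//; apply: (@le_trans _ _ (`|k| ^+ m));
    last by rewrite lerDl.
  by rewrite lerXn2r ?nnegrE.
- by apply: measurable_funB; exact: measurable_moment_along.
- by rewrite ltW// divr_gt0.
Qed.

(** The moment order goes up by one because scaling the argument by [r] scales
    the increment by [r] as well. *)
Lemma radial_average_is_derive m g x v : smooth g ->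
  is_derive x v (radial_average m g) (radial_average m.+1 (along v g) x).
Proof.
move=> sg; have cg := smooth_continuous sg.
have cg' := smooth_continuous (smooth_along v sg).
apply/is_deriveP => e e0.
pose c := e / 2 / (`|k| ^+ m.+1 + 1).
have c0 : 0 < c by rewrite !divr_gt0// ltr_wpDl// exprn_ge0.
have [d d0 Hd] := continuous_uniform_along x k cg' c0.
have K0 : 0 < `|k| * `|v| + 1 by rewrite ltr_wpDl// mulr_ge0.
exists (d / (`|k| * `|v| + 1)) => [|h h0 hd]; first by rewrite divr_gt0.
rewrite /radial_average -RintegralB//; [|exact: integrable_moment_along..].
have I1 := @integrableB_EFin _ _ _ P _ _ _ (measurable_itv _)
  (integrable_moment_along m (x + h *: v) cg) (integrable_moment_along m x cg).
rewrite -RintegralZl// -RintegralB//; last 2 first.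
- exact: integrableZ_EFin.
- exact: integrable_moment_along.
have M1 : measurable_fun K (fun r : R =>
    h^-1 * (r ^+ m * g (r *: (x + h *: v)) - r ^+ m * g (r *: x))).
  apply: measurable_funM => //.
  by apply: measurable_funB; exact: measurable_moment_along.
apply: (@le_lt_trans _ _ (e / 2)); last by rewrite ltr_pdivrMr// ltr_pMr//
  ltr1n.
apply: Rintegral_bound => //; last 1 first.
- move=> r /=; rewrite in_itv/= => rk; have /andP[r0 rlek] := rk.
  have rK : `|r| <= `|k| by rewrite !ger0_norm// (le_trans r0).
  have [s sc E] := MVT_line (fun y => smooth_is_derive y v sg) (r *: x) (r * h).
  have -> : h^-1 * (r ^+ m * g (r *: (x + h *: v)) - r ^+ m * g (r *: x)) -
      r ^+ m.+1 * along v g (r *: x) =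
      r ^+ m.+1 * (along v g (r *: x + s *: v) - along v g (r *: x)).
    rewrite -mulrBr scalerDr scalerA E exprS; by field.
  have lt : `|along v g (r *: x + s *: v) - along v g (r *: x)| < c.
    apply: Hd => //; rewrite normrZ; move: hd; rewrite ltr_pdivlMr//.
    apply: le_lt_trans; apply: (@le_trans _ _ (`|h| * (`|k| * `|v|))).
      rewrite mulrA ler_wpM2r// (le_trans sc)// normrM mulrC ler_wpM2l//.
    by rewrite ler_wpM2l// lerDl.
  rewrite normrM normrX.
  move: lt; rewrite /c ltr_pdivlMr ?ltr_wpDl ?exprn_ge0// => /ltW;
    apply: le_trans.
  rewrite mulrC ler_wpM2l//; apply: (@le_trans _ _ (`|k| ^+ m.+1));
    last by rewrite lerDl.
  by rewrite lerXn2r ?nnegrE.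
- by apply: measurable_funB => //; exact: measurable_moment_along.
- by rewrite ltW// divr_gt0.
Qed.

Lemma partial_radial_average m g i : smooth g ->
  partial i (radial_average m g) = radial_average m.+1 (partial i g).
Proof.
move=> sg; apply/funext => x; have [_] := radial_average_is_derive m x (e_ i)
  sg.
by rewrite along_delta.
Qed.

(** Every iterated partial derivative of such an average is again such an
    average, hence continuous and differentiable. *)
Lemma smooth_radial_average m g : smooth g -> smooth (radial_average m g).
Proof.
move=> sg s; have [j [h sh ->]] : exists j, exists2 h, smooth h &
    partials s (radial_average m g) = radial_average j h.
  elim: s => [|i s [j [h sh E]]]; first by exists m, g.
  exists j.+1, (partial i h); first exact: smooth_partial.
  by rewrite [LHS]/= -/(partials s _) E partial_radial_average.
move=> x _; split.
  by apply: radial_average_continuous; exact: smooth_continuous.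
by move=> i; have [] := radial_average_is_derive j x (e_ i) sh.
Qed.

Lemma along_radial_average m g x v : smooth g ->
  along v (radial_average m g) x = radial_average m.+1 (along v g) x.
Proof.
move=> sg; have [_ <-] := radial_average_is_derive m x v sg.
by have [_ <-] := smooth_is_derive x v (smooth_radial_average m sg).
Qed.

End TruncatedRadialAverages.

(** * Borel sets and measures carried by a subset *)

Section BorelRn.
Context {R : realType} {n : nat}.

Lemma open_measurable_Rn (U : set 'rV[R]_n) : open U ->
  measurable (U : set (Rn R n)).
Proof. by move=> oU; exact: sub_sigma_algebra. Qed.

Lemma continuous_measurable_Rn (f : 'rV[R]_n -> R) : continuous f ->
  measurable_fun setT (f : Rn R n -> R).
Proof.
move=> /continuousP cf; apply: (measurability _ (RGenOpens.measurableE R)).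
move=> _ [_ [a [b ->] <-]]; rewrite setTI.
by apply: open_measurable_Rn; apply: cf; exact: interval_open.
Qed.

Lemma dotv_continuous (w : 'rV[R]_n -> 'rV[R]_n) :
  (forall i, continuous (fun x => w x ord0 i)) ->
  continuous (fun x => dotv (w x) (w x)).
Proof.
move=> cw; apply: (continuous_big add_continuous) => i _ x.
exact: (cvgM (cw i x) (cw i x)).
Qed.

Lemma measurable_sphere : measurable (sphere : set (Rn R n)).
Proof.
have C : continuous (fun x : 'rV[R]_n => dotv x x).
  by apply: (@dotv_continuous id) => i; exact: coord_continuous.
rewrite (_ : sphere = (fun x : Rn R n => dotv (x : 'rV[R]_n) x) @^-1` [set
  1])//.
rewrite -[X in measurable X]setTI.
exact: (continuous_measurable_Rn C).
Qed.

(** The scalars are confined to compact intervals with rational endpoints so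
    that the tube lemma applies to the vectors: the preimage of an open set is
    then a countable union of measurable rectangles. *)
Lemma measurable_polar :
  measurable_fun setT (polar : measurableTypeR R * Rn R n -> Rn R n).
Proof.
have E : @measurable _ (Rn R n) = <<s @open 'rV[R]_n >> by [].
apply: (measurability _ E) => _ [U oU <-]; rewrite setTI.
pose A (q : rat * rat) : set (measurableTypeR R) :=
  `](ratr q.1 : R), ratr q.2[%classic.
pose B (q : rat * rat) : set 'rV[R]_n :=
  [set x | `[(ratr q.1 : R), ratr q.2] `<=` [set r : R | U (r *: x)]].
have oB q : open (B q).
  rewrite openE => x Bx.
  have /compact_near_coveringP cov := @segment_compact R (ratr q.1) (ratr q.2).
  have := cov 'rV[R]_n (nbhs x) (fun y r => U (r *: y)) (nbhs_filter x).
  apply=> r rq.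
  have C : {for (r, x), continuous (fun p : R * 'rV[R]_n => p.1 *: p.2)}.
    exact: scale_continuous.
  apply: C; move: oU; rewrite openE; apply; exact: Bx.
have -> : polar @^-1` U = \bigcup_(q : rat * rat) (A q `*` B q).
  apply/seteqP; split=> [[r x] /= Urx|[r x] [[q1 q2] _ [/= Ar Bx]]]; last first.
    by apply: Bx => /=; apply: subset_itv_oo_cc.
  have C : {for r, continuous (fun s : R => s *: x)}.
    by apply: cvgZr_tmp; exact: cvg_id.
  have : \forall s \near r, U (s *: x).
    by apply: C; move: oU; rewrite openE; apply.
  move=> /nbhs_ballP[d /= d0 Hd].
  have [p] := @rat_in_itvoo R (r - d) r ltac:(by rewrite ltrBlDr ltrDl).
  rewrite in_itv/= => /andP[p1 p2].
  have [q] := @rat_in_itvoo R r (r + d) ltac:(by rewrite ltrDl).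
  rewrite in_itv/= => /andP[q1 q2].
  exists (p, q) => //; split; first by rewrite /A /= in_itv/= p2 q1.
  move=> s /=; rewrite in_itv/= => /andP[ps sq]; apply: Hd.
  rewrite -ball_normE/= ltr_norml; lra.
apply: countable_bigcupT_measurable => // q; apply: measurableX;
  first exact: measurable_itv.
exact: (open_measurable_Rn (oB q)).
Qed.

End BorelRn.

Section CarriedMeasures.
Local Open Scope ereal_scope.
Context d {T : measurableType d} {R : realType}.

Lemma integral_carried (P : probability T R) (D : set T) (f : T -> \bar R) :
  measurable D -> P (~` D) = 0 -> measurable_fun setT f ->
  \int[P]_(x in D) f x = \int[P]_x f x.
Proof.
move=> mD D0 mf.
have H (g : T -> \bar R) : measurable_fun setT g -> (forall x, 0 <= g x) ->
    \int[P]_x g x = \int[P]_(x in D) g x.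
  move=> mg g0; rewrite (@ge0_negligible_integral _ _ _ P setT (~` D))//.
    by rewrite setTD setCK.
  exact: measurableC.
rewrite integralE [RHS]integralE !H//.
- exact: measurable_funeneg.
- exact: measurable_funepos.
Qed.

Lemma density_carried (lambda : {measure set T -> \bar R}) (D : set T)
    (w : T -> R) (P : probability T R) :
  measurable D -> density_proportional_to lambda D w P -> P (~` D) = 0.
Proof.
move=> mD [_ [c _ ->]]; last exact: measurableC.
by rewrite setICl integral_set0.
Qed.

Lemma density_null (lambda : {measure set T -> \bar R}) (D N : set T)
    (w : T -> R) (P : probability T R) :
  measurable D -> measurable N -> density_proportional_to lambda D w P ->
  lambda N = 0 -> P N = 0.
Proof.
move=> mD mN [mw [c _ ->//]] N0; apply: null_set_integral.
- exact: measurableI.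
- apply/measurable_EFinP; apply: measurable_funM => //.
  by apply: measurable_funS mw => //; exact: subIsetr.
apply/eqP; rewrite eq_le measure_ge0 andbT -N0 le_measure ?inE//.
exact: measurableI.
Qed.

End CarriedMeasures.

Section SecondMoment.
Context {R : realType}.

(** A vanishing second moment would concentrate the measure at the origin, which
    is Lebesgue-null. *)
Lemma second_moment_gt0 (w : R -> R) (mur : probability (measurableTypeR R) R) :
  density_proportional_to lebesgue_measure Rplus w mur ->
  (0 < second_moment mur)%E.
Proof.
move=> dw; have mp : measurable (Rplus : set (measurableTypeR R)).
  exact: measurable_itv.
rewrite lt0e integral_ge0 ?andbT; last by move=> x _; rewrite lee_fin sqr_ge0.
apply/negP => /eqP m0.
have mf : measurable_fun setT (fun r : measurableTypeR R => (r ^+ 2)%:E).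
  by apply/measurable_EFinP; exact: exprn_measurable.
have : ae_eq mur setT (fun r : measurableTypeR R => (r ^+ 2)%:E) (cst 0%E).
  apply/ae_eq_integral_abs => //.
  rewrite -m0 /second_moment integral_carried//; last exact: density_carried dw.
  by apply: eq_integral => r _; rewrite gee0_abs// lee_fin sqr_ge0.
have n0 : mur [set 0] = 0%E.
  by apply: (density_null mp _ dw); [exact: measurable_set1|exact:
    lebesgue_measure_set1].
move=> [N [mN N0 HN]]; have := probability_setT mur.
have -> : [set: measurableTypeR R] = N `|` [set 0].
  apply/seteqP; split=> // r _; have [->|r0] := eqVneq r 0; [by right|left].
  apply: HN => /= /(_ I) /eqP; rewrite eqe sqrf_eq0; exact/negP.
rewrite measureU0//; first by rewrite N0 => /esym/eqP; rewrite onee_eq0.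
Qed.

End SecondMoment.

(** * Integration in polar coordinates *)

Section IteratedIntegrals.
Context d1 d2 {X : measurableType d1} {Y : measurableType d2} {R : realType}.
Variables (P : probability X R) (Q : probability Y R).
Variables (g : X * Y -> R) (M : R).
Hypotheses (mg : measurable_fun setT g) (gM : forall z, `|g z| <= M).

Lemma measurable_section y : measurable_fun setT (fun x => g (x, y)).
Proof. exact: measurable_fun_pair1. Qed.

Lemma integrable_section y : P.-integrable setT (EFin \o (fun x => g (x, y))).
Proof.
apply: (@bounded_integrable _ _ _ P _ _ M) => //.
exact: measurable_section.
Qed.

Lemma bounded_integrable_prod : (P \x Q)%E.-integrable setT (EFin \o g).
Proof.
have mEg : measurable_fun setT (EFin \o g) by exact/measurable_EFinP.
apply/(integrable21ltyP P Q mEg).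
apply: (@le_lt_trans _ _ (\int[Q]_y (cst M%:E y))%E); last first.
  by rewrite integral_cst//= probability_setT mule1 ltry.
have mA : measurable_fun setT (abse \o (EFin \o g)) by exact: measurableT_comp.
apply: ge0_le_integral => //.
- by move=> y _; apply: integral_ge0 => x _; exact: abse_ge0.
- by apply: (measurable_fun_fubini_tonelli_G (abse \o (EFin \o g)) mA) =>
  z /=; rewrite lee_fin.
- move=> y _; apply: (@le_trans _ _ (\int[P]_x (cst M%:E x))%E); last first.
    by rewrite integral_cst//= probability_setT mule1.
  apply: ge0_le_integral => //.
  + apply: measurableT_comp => //; apply/measurable_EFinP;
    exact: measurable_section.
  + by move=> x _ /=; rewrite lee_fin.
Qed.

Lemma EFin_section y : (\int[P]_x g (x, y))%:E = (\int[P]_x (g (x, y))%:E)%E.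
Proof.
by rewrite fineK//; apply: integrable_fin_num => //; exact: integrable_section.
Qed.

Lemma measurable_Rintegral_section :
  measurable_fun setT (fun y => \int[P]_x g (x, y)).
Proof.
apply: (measurableT_comp (fine_measurable measurableT)).
exact: (measurable_fubini_G bounded_integrable_prod).
Qed.

Lemma Rintegral_section_bound y : `|\int[P]_x g (x, y)| <= M.
Proof.
apply: Rintegral_bound => //; first exact: measurable_section.
by apply: le_trans (gM (point, point)).
Qed.

(** The inner integral is real-valued, so that its square can be formed; this is
    what the decomposition of the variance is about. *)
Lemma integral_iterated :
  (\int[(P \x Q)%E]_z (g z)%:E)%E = (\int[Q]_y \int[P]_x g (x, y))%:E.
Proof.
rewrite -(integral21_prod_meas1 bounded_integrable_prod).
rewrite fineK; last first.
  apply: integrable_fin_num => //.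
  apply: (@bounded_integrable _ _ _ Q _ _ M) => //.
    exact: measurable_Rintegral_section.
  by move=> y _; exact: Rintegral_section_bound.
by apply: eq_integral => y _; rewrite EFin_section.
Qed.

End IteratedIntegrals.

Section PolarIntegration.
Context {R : realType} {n : nat}.
Variables (mu : probability (Rn R n) R) (P : probability (measurableTypeR R) R)
  (Q : probability (Rn R n) R).
Hypothesis muE : forall A : set (Rn R n), measurable A ->
  mu A = pushforward (P \x Q)%E polar A.

Lemma ge0_integral_polar (h : Rn R n -> \bar R) :
  measurable_fun setT h -> (forall x, (0 <= h x)%E) ->
  (\int[mu]_x h x = \int[Q]_y \int[P]_r h (polar (r, y)))%E.
Proof.
move=> mh h0; have mhp : measurable_fun setT (h \o polar).
  by apply: measurableT_comp => //; exact: measurable_polar.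
rewrite -(fubini_tonelli2 (h \o polar)) => //; last by move=> z; exact: h0.
have := @ge0_integral_pushforward _ _ _ _ _ _ measurable_polar
  (P \x Q)%E setT h measurableT mh (fun x _ => h0 x).
rewrite preimage_setT => <-.
apply: eq_measure_integral => [|mp A mA _];
  [exact: measurable_polar|exact: muE].
Qed.

Lemma bounded_integral_polar (h : Rn R n -> R) (M : R) :
  measurable_fun setT h -> (forall x, `|h x| <= M) ->
  (\int[mu]_x (h x)%:E)%E = (\int[Q]_y \int[P]_r h (polar (r, y)))%:E.
Proof.
move=> mh hM; have mhp : measurable_fun setT (h \o polar).
  by apply: measurableT_comp => //; exact: measurable_polar.
rewrite -(integral_iterated P Q mhp (fun z => hM (polar z))).
have mEh : measurable_fun setT (EFin \o h) by exact/measurable_EFinP.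
have ih : (P \x Q)%E.-integrable (polar @^-1` setT) ((EFin \o h) \o polar).
  rewrite preimage_setT.
  exact: (bounded_integrable_prod P Q mhp (fun z => hM (polar z))).
have := integral_pushforward measurable_polar mEh ih measurableT.
rewrite preimage_setT => <-.
apply: eq_measure_integral => [|mp A mA _];
  [exact: measurable_polar|exact: muE].
Qed.

End PolarIntegration.

(** * Oscillation, variance and weak Poincare inequalities *)

Section Oscillation.
Context d {T : measurableType d} {R : realType}.
Implicit Types (D : set T) (g : T -> R).

(** Either the oscillation term makes the inequality trivial or the test
    function is bounded. *)
Lemma Osc_dichotomy D g : D !=set0 ->
  Osc D g = +oo%E \/ exists o M, [/\ Osc D g = o%:E,
    forall x y, D x -> D y -> g x - g y <= o & forall x, D x -> `|g x| <= M].
Proof.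
move=> [x0 Dx0]; rewrite /Osc; set A := [set _ | x in D].
have A0 x : D x -> A (g x)%:E by exists x.
have sup_ge x : D x -> ((g x)%:E <= ereal_sup A)%E by move=> Dx;
  exact/ereal_sup_ubound/A0.
have inf_le x : D x -> (ereal_inf A <= (g x)%:E)%E by move=> Dx;
  exact/ereal_inf_lbound/A0.
move: sup_ge inf_le; case: (ereal_sup A) => [s||] sup_ge inf_le; last 2 first.
- left; move: inf_le; case: (ereal_inf A) => [i||] // /(_ _ Dx0).
  by rewrite leye_eq.
- by have := sup_ge _ Dx0; rewrite leeNy_eq.
move: inf_le; case: (ereal_inf A) => [i||] inf_le; [right|..|by left];
  last first.
  by have := inf_le _ Dx0; rewrite leye_eq.
exists (s - i), (`|s| + `|i|); split=> //.
  by move=> x y /sup_ge + /inf_le; rewrite !lee_fin => *; exact: lerB.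
move=> x Dx; have := sup_ge _ Dx; have := inf_le _ Dx;
  rewrite !lee_fin => ix xs.
rewrite ler_norml; have := ler_norm s; have := ler_norm (- i); rewrite normrN.
by have := normr_ge0 s; have := normr_ge0 i; lra.
Qed.

(** Nonemptiness matters: over the empty set the supremum is [-oo] and the
    infimum [+oo], and the square of the oscillation is [+oo]. *)
Lemma Osc_sqr_le D g o : D !=set0 ->
  (forall x y, D x -> D y -> g x - g y <= o) -> (Osc D g ^+ 2 <= (o ^+ 2)%:E)%E.
Proof.
move=> [x0 Dx0] go; rewrite /Osc; set A := [set _ | x in D].
have A0 x : D x -> A (g x)%:E by exists x.
have sup_ge : ((g x0)%:E <= ereal_sup A)%E by exact/ereal_sup_ubound/A0.
have inf_le : (ereal_inf A <= (g x0)%:E)%E by exact/ereal_inf_lbound/A0.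
have sup_le y : D y -> (ereal_sup A <= (g y + o)%:E)%E.
  move=> Dy; apply: ge_ereal_sup => _ [x Dx <-]; rewrite lee_fin.
  by have := go _ _ Dx Dy; lra.
move: sup_ge sup_le; case: (ereal_sup A) => [s||] sup_ge sup_le; last 2 first.
- by have := sup_le _ Dx0; rewrite leye_eq.
- by move: sup_ge; rewrite leeNy_eq.
have inf_ge : ((s - o)%:E <= ereal_inf A)%E.
  apply: le_ereal_inf_tmp => _ [x Dx <-]; rewrite lee_fin.
  by have := sup_le _ Dx; rewrite lee_fin; lra.
move: inf_le inf_ge; case: (ereal_inf A) => [i|/=|/=] //.
rewrite !lee_fin => ix0 soi; rewrite -expr2.
have : 0 <= s - i by move: sup_ge; rewrite lee_fin; lra.
by move=> si; rewrite lerXn2r// ?nnegrE; lra.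
Qed.

End Oscillation.

Section Variance.
Context d {T : measurableType d} {R : realType} (P : probability T R).
Implicit Types (u v : T -> R).

Definition Rvariance u : R := \int[P]_x (u x ^+ 2) - (\int[P]_x u x) ^+ 2.

Lemma bounded_sqr u (M : R) : (forall x, `|u x| <= M) ->
  forall x, `|u x ^+ 2| <= M ^+ 2.
Proof.
by move=> uM x; rewrite normrX lerXn2r ?nnegrE ?(le_trans _ (uM x)).
Qed.

Lemma integrable_bounded u (M : R) : measurable_fun setT u ->
  (forall x, `|u x| <= M) -> P.-integrable setT (EFin \o u).
Proof. by move=> mu uM; apply: (@bounded_integrable _ _ _ P _ _ M). Qed.

Lemma integrable_bounded_sqr u (M : R) : measurable_fun setT u ->
  (forall x, `|u x| <= M) -> P.-integrable setT (EFin \o (fun x => u x ^+ 2)).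
Proof.
move=> mu uM; apply: (@integrable_bounded _ (M ^+ 2)).
  exact: measurable_funX.
exact: bounded_sqr.
Qed.

Lemma Rvariance_ge0 u (M : R) : measurable_fun setT u ->
  (forall x, `|u x| <= M) ->
  0 <= Rvariance u.
Proof.
move=> mu uM; rewrite subr_ge0.
have := @Rintegral_cauchy_schwarz _ _ _ P setT u (cst 1) M 1 measurableT mu.
move=> /(_ (measurable_cst _) (fun x _ => uM x)).
move=> /(_ (fun x _ => ltac:(by rewrite normr1))).
under eq_Rintegral do rewrite mulr1.
under [X in _ <= _ * X -> _]eq_Rintegral do rewrite expr1n.
by rewrite Rintegral_cst// (_ : fine (P setT) = 1) ?mulr1//;
  have -> := probability_setT P.
Qed.

(** Both the mean of the square and the square of the mean change by at most
    [2 * M * e], as [u ^+ 2 - v ^+ 2] factors. *)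
Lemma Rvariance_le_uniform u v (M e : R) :
  measurable_fun setT u -> measurable_fun setT v ->
  (forall x, `|u x| <= M) -> (forall x, `|v x| <= M) ->
  (forall x, `|u x - v x| <= e) -> Rvariance u <= Rvariance v + 4 * M * e.
Proof.
move=> mu mv uM vM uv.
have iu := integrable_bounded mu uM; have iv := integrable_bounded mv vM.
have iu2 := integrable_bounded_sqr mu uM;
  have iv2 := integrable_bounded_sqr mv vM.
have M0 : 0 <= M by apply: le_trans (uM point).
have e0 : 0 <= e by apply: le_trans (uv point).
have H1 : `|\int[P]_x (u x ^+ 2 - v x ^+ 2)| <= 2 * M * e.
  apply: Rintegral_bound => //.
  - by apply: measurable_funB; exact: measurable_funX.
  - by rewrite !mulr_ge0.
  - move=> x _; rewrite subr_sqr normrM mulrC ler_pM//.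
    by rewrite (le_trans (ler_normD _ _))// mulr2n mulrDl mul1r lerD.
have H2 : `|\int[P]_x (u x - v x)| <= e.
  by apply: Rintegral_bound => //; exact: measurable_funB.
have H3 : `|\int[P]_x u x| <= M by apply: Rintegral_bound.
have H4 : `|\int[P]_x v x| <= M by apply: Rintegral_bound.
move: H1 H2; rewrite !RintegralB// /Rvariance.
set a := \int[P]_x (u x ^+ 2); set b := \int[P]_x (v x ^+ 2).
move: H3 H4; set p := \int[P]_x u x; set q := \int[P]_x v x.
move=> H3 H4 H1 H2.
have H5 : `|p ^+ 2 - q ^+ 2| <= 2 * M * e.
  rewrite subr_sqr normrM mulrC ler_pM//.
  by rewrite (le_trans (ler_normD _ _))// mulr2n mulrDl mul1r lerD.
move: H1 H5; rewrite !ler_norml => /andP[_ h1] /andP[h2 _].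
by lra.
Qed.

Lemma EFin_Rvariance u (M : R) : measurable_fun setT u ->
  (forall x, `|u x| <= M) ->
  ((Rvariance u)%:E =
     \int[P]_x (u x ^+ 2)%:E - (\int[P]_x (u x)%:E) ^+ 2)%E.
Proof.
move=> mu uM; rewrite /Rvariance EFinB EFin_expe !fineK//.
  by apply: integrable_fin_num => //; exact: integrable_bounded mu uM.
by apply: integrable_fin_num => //; exact: integrable_bounded_sqr mu uM.
Qed.

End Variance.

Section LawOfTotalVariance.
Context d1 d2 {X : measurableType d1} {Y : measurableType d2} {R : realType}.
Variables (P : probability X R) (Q : probability Y R).

Variables (g : X * Y -> R) (M : R).
Hypotheses (mg : measurable_fun setT g) (gM : forall z, `|g z| <= M).

Let mg2 : measurable_fun setT (fun z => g z ^+ 2).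
Proof. exact: measurable_funX. Qed.

Let mF := measurable_Rintegral_section P Q mg gM.
Let FM := Rintegral_section_bound P mg gM.
Let mS := measurable_Rintegral_section P Q mg2 (bounded_sqr gM).
Let SM := Rintegral_section_bound P mg2 (bounded_sqr gM).

Lemma measurable_Rvariance_section :
  measurable_fun setT (fun y => Rvariance P (fun x => g (x, y))).
Proof. by apply: measurable_funB => //; exact: measurable_funX. Qed.

Lemma integrable_Rvariance_section :
  Q.-integrable setT (EFin \o (fun y => Rvariance P (fun x => g (x, y)))).
Proof.
apply: integrableB_EFin => //; first exact: integrable_bounded mS SM.
exact: integrable_bounded_sqr mF FM.
Qed.

Lemma total_variance :
  \int[Q]_y (\int[P]_x (g (x, y) ^+ 2)) - (\int[Q]_y \int[P]_x g (x, y)) ^+ 2 =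
  \int[Q]_y (Rvariance P (fun x => g (x, y))) + Rvariance Q (fun y =>
    \int[P]_x g (x, y)).
Proof.
rewrite /Rvariance RintegralB//.
- by ring.
- exact: integrable_bounded mS SM.
- exact: integrable_bounded_sqr mF FM.
Qed.

End LawOfTotalVariance.

Section WeakPoincareFacts.
Context d {T : measurableType d} {R : realType} (nu : probability T R).
Variables (D : set T) (smooth : set (T -> R)) (gradsq : (T -> R) -> T -> R).
Hypotheses (mD : measurable D) (D0 : D !=set0) (nuD : nu (~` D) = 0%E).

(** For bounded test functions all terms on the left are finite, and the
    inequality can be stated with a real variance. *)
Lemma weak_poincare_bounded (b : R -> \bar R) (u : T -> R) (M o s : R) :
  weak_poincare nu D smooth gradsq b -> smooth u -> 0 < s ->
  measurable_fun setT u -> (forall x, `|u x| <= M) ->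
  (forall x y, D x -> D y -> u x - u y <= o) ->
  ((Rvariance nu u)%:E <=
    b s * \int[nu]_(x in D) (gradsq u x)%:E + (s * o ^+ 2)%:E)%E.
Proof.
move=> wp su s0 mu uM uo.
rewrite (EFin_Rvariance nu mu uM) -!(integral_carried mD nuD); last 2 first.
- exact/measurable_EFinP.
- by apply/measurable_EFinP; exact: measurable_funX.
apply: (le_trans (wp s u s0 su)); rewrite leeD2l// EFinM.
by rewrite lee_pmul2l// Osc_sqr_le.
Qed.

Lemma betaWP_ge0 s : 0 < s -> (0 <= betaWP nu D smooth gradsq s)%E.
Proof. by move=> s0; apply: le_ereal_inf_tmp => _ [b [b0 _ _] <-];
  exact: b0. Qed.

Lemma betaWP_nonincreasing s t : 0 < s -> s <= t ->
  (betaWP nu D smooth gradsq t <= betaWP nu D smooth gradsq s)%E.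
Proof.
move=> s0 st; apply: le_ereal_inf_tmp => _ [b bA <-].
apply: le_trans (_ : (b t <= _)%E); first by apply: ereal_inf_lbound; exists b.
by have [_ bs _] := bA; exact: bs.
Qed.

(** The inequality passes to the infimum of the constants because the energy
    is finite: multiplication by an infinite energy would not be continuous
    at zero. *)
Lemma le_ereal_inf_mulD (S : set (\bar R)) (c y z : R) :
  S !=set0 -> 0 <= c ->
  (forall a, S a -> (y%:E <= a * c%:E + z%:E)%E) ->
  (y%:E <= ereal_inf S * c%:E + z%:E)%E.
Proof.
move=> [a0 Sa0]; rewrite le_eqVlt => /orP[/eqP <-|c0] H.
  by have := H _ Sa0; rewrite !mule0.
have : (((y - z) / c)%:E <= ereal_inf S)%E.
  apply: le_ereal_inf_tmp => a /H; case: a => [a||]; rewrite ?leey//.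
    by rewrite -EFinM -EFinD !lee_fin ler_pdivrMr// lerBlDr.
  by rewrite gt0_mulNye// addNye leeNy_eq.
rewrite -(@lee_pmul2r _ c%:E)// -EFinM divfK ?gt_eqF// EFinB.
by rewrite leeBlDr.
Qed.

End WeakPoincareFacts.

(** * Radial and angular parts of the variance *)

Section SphereEnergy.
Context {R : realType} {n : nat}.
Local Notation smooth f := (smooth_on (@setT 'rV[R]_n) f).

Lemma compact_sphere : compact (sphere : set 'rV[R]_n).
Proof.
apply: bounded_closed_compact.
  exists 1; split; first exact: num_real.
  move=> M M1 x x1; apply: le_trans (ltW M1).
  rewrite /Num.norm/= mx_normrE; apply/bigmax_leP; split=> // -[i j] _ /=.
  rewrite (ord1 i) -(@expr_le1 _ 2)// real_normK ?num_real//.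
  rewrite -x1 /dotv (bigD1 j)//= expr2 lerDl.
  by apply: sumr_ge0 => l _; rewrite -expr2 sqr_ge0.
have C : continuous (fun x : 'rV[R]_n => dotv x x).
  by apply: (@dotv_continuous _ _ id) => i; exact: coord_continuous.
exact: (closed_comp (fun x _ => C x) (@closed_eq R 1)).
Qed.

Lemma continuous_sphere_energy (f : 'rV[R]_n -> R) : smooth f ->
  continuous (fun x => dotv (sphere_grad f x) (sphere_grad f x)).
Proof.
move=> sf; have cp i : continuous (partial i f).
  exact/smooth_continuous/smooth_partial.
have cc i : continuous (fun x : 'rV[R]_n =>
  x ord0 i) by exact: coord_continuous.
apply: dotv_continuous => i.
have -> : (fun x => sphere_grad f x ord0 i) =
    (fun x => partial i f x - (\sum_j partial j f x * x ord0 j) * x ord0 i).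
  apply/funext => x; rewrite !mxE; congr (_ - _ * _).
  by apply: eq_bigr => j _; rewrite mxE.
have cs : continuous (fun x : 'rV[R]_n => \sum_j partial j f x * x ord0 j).
  by apply: (continuous_big add_continuous) => j _ x;
    exact: (cvgM (cp j x) (cc j x)).
by move=> x; exact: (cvgB (cp i x) (cvgM (cs x) (cc i x))).
Qed.

(** By compactness of the sphere; this finiteness is what lets the inequality
    on the sphere pass to the infimum of the admissible functions. *)
Lemma sphere_energy_fin_num (Q : probability (Rn R n) R) (f : 'rV[R]_n -> R) :
  smooth f ->
  (\int[Q]_(x in sphere) (dotv (sphere_grad f x) (sphere_grad f x))%:E
     \is a fin_num)%E.
Proof.
move=> sf; have ce := continuous_sphere_energy sf.
have /compact_bounded[M [_ HM]] :
    compact ((fun x => dotv (sphere_grad f x) (sphere_grad f x)) @` sphere).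
  by apply: continuous_compact; [exact: continuous_subspaceT|exact:
    compact_sphere].
apply: integrable_fin_num; first exact: measurable_sphere.
apply: (@bounded_integrable _ _ _ Q _ _ (`|M| + 1)).
- exact: measurable_sphere.
- by apply: measurable_funTS; exact: continuous_measurable_Rn.
- move=> x xS; apply: HM; last by exists x.
  by rewrite (le_lt_trans (ler_norm M))// ltrDl.
Qed.

End SphereEnergy.

Section Tail.
Context {R : realType} (P : probability (measurableTypeR R) R).

(** Continuity from above along the complements of the intervals [`[0, k]]. *)
Lemma radial_tail_small (e : R) : P (~` Rplus) = 0%E -> 0 < e ->
  exists k : R, fine (P (~` `[0, k]%classic)) < e.
Proof.
move=> P0 e0; pose A (k : nat) : set (measurableTypeR R) :=
  ~` `[0, k%:R]%classic.
have mA k : measurable (A k) by apply: measurableC; exact: measurable_itv.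
have AE : \bigcap_k A k = ~` Rplus.
  rewrite -setC_bigcup; congr (~` _); apply/seteqP; split=> [x [k _]|x]/=.
    by rewrite /Rplus /= !in_itv/= andbT => /andP[].
  rewrite /Rplus /= in_itv/= andbT => x0.
  exists (Num.truncn x).+1 => //=; rewrite in_itv/= x0/= ltW//.
  exact: truncnS_gt.
have cA : (P \o A) k @[k --> \oo] --> 0%E.
  rewrite -P0 -AE; apply: nonincreasing_cvg_mu => //.
  - by rewrite (le_lt_trans (probability_le1 P (mA 0%N)))// ltry.
  - exact: bigcapT_measurable.
  - move=> i j ij; apply/subsetPset => x; apply: contra_not => /=.
    rewrite !in_itv/= => /andP[-> /le_trans]; apply.
    by rewrite ler_nat.
have /fine_cvgP[_ /cvgrPdist_lt/(_ e e0)] := cA.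
move=> [N _ /(_ N (leqnn _))] /=; rewrite sub0r normrN => PN.
by exists N%:R; apply: le_lt_trans PN; exact: ler_norm.
Qed.

End Tail.

Section TwoParts.
Context {R : realType} {n : nat}.
Variables (P : probability (measurableTypeR R) R) (Q : probability (Rn R n) R).
Hypotheses (P0 : P (~` Rplus) = 0%E) (Q0 : Q (~` sphere) = 0%E).
Variables (f : 'rV[R]_n -> R) (M o : R).
Hypotheses (sf : smooth_on setT f) (fM : forall x, `|f x| <= M)
  (fo : forall x y, f x - f y <= o).

Let X : measurableType _ := measurableTypeR R.
Let Y := Rn R n.
Let fp (z : X * Y) : R := f (polar z).
Let F (y : Y) : R := \int[P]_r fp (r, y).

Definition radial_energy : \bar R :=
  (\int[Q]_y \int[P]_r (along (y : 'rV[R]_n) f (polar (r, y)) ^+ 2)%:E)%E.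

Definition tangential_energy : \bar R :=
  (\int[Q]_y \int[P]_r
     (\sum_i along (tangent (y : 'rV[R]_n) i) f (polar (r, y)) ^+ 2)%:E)%E.

Let mfp : measurable_fun setT fp.
Proof.
apply: measurableT_comp; last exact: measurable_polar.
exact: (continuous_measurable_Rn (smooth_continuous sf)).
Qed.

Let fpM z : `|fp z| <= M. Proof. exact: fM. Qed.

Let mpartial i : measurable_fun setT (fun z : X * Y => partial i f (polar z)).
Proof.
apply: measurableT_comp; last exact: measurable_polar.
exact: (continuous_measurable_Rn (smooth_continuous (smooth_partial i sf))).
Qed.

Let mcoord i : measurable_fun setT (fun z : X * Y => (z.2 : 'rV[R]_n) ord0 i).
Proof.
have mc : measurable_fun setT (fun x : Y => (x : 'rV[R]_n) ord0 i).
  by apply: continuous_measurable_Rn; exact: coord_continuous.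
exact: (measurableT_comp mc measurable_snd).
Qed.

Let malong :
  measurable_fun setT (fun z : X * Y => along (z.2 : 'rV[R]_n) f (polar z)).
Proof.
by apply: measurable_sum => i; exact: (measurable_funM (mcoord i) (mpartial i)).
Qed.

Let malong_sqr : measurable_fun setT
  (fun z : X * Y => (along (z.2 : 'rV[R]_n) f (polar z) ^+ 2)%:E).
Proof. by apply/measurable_EFinP; exact: (measurable_funX _ malong). Qed.

Let mtangent i : measurable_fun setT
  (fun z : X * Y => along (tangent (z.2 : 'rV[R]_n) i) f (polar z)).
Proof.
rewrite (_ : (fun z => _) = (fun z : X * Y => partial i f (polar z) -
    (z.2 : 'rV[R]_n) ord0 i * along (z.2 : 'rV[R]_n) f (polar z))).
  exact: (measurable_funB (mpartial i) (measurable_funM (mcoord i) malong)).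
by apply/funext => z; rewrite along_tangent.
Qed.

Let mtangent_sqr : measurable_fun setT (fun z : X * Y =>
  (\sum_i along (tangent (z.2 : 'rV[R]_n) i) f (polar z) ^+ 2)%:E).
Proof.
apply/measurable_EFinP; apply: measurable_sum => i.
exact: (measurable_funX _ (mtangent i)).
Qed.

Lemma radial_energy_ge0 : (0 <= radial_energy)%E.
Proof.
by apply: integral_ge0 => y _; apply: integral_ge0 => r _;
  rewrite lee_fin sqr_ge0.
Qed.

Lemma tangential_energy_ge0 : (0 <= tangential_energy)%E.
Proof.
apply: integral_ge0 => y _; apply: integral_ge0 => r _; rewrite lee_fin.
by apply: sumr_ge0 => i _; exact: sqr_ge0.
Qed.

(** The pointwise splitting holds for unit directions only, which is enough
    because [Q] is carried by the sphere. *)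
Lemma energy_split (mu : probability Y R) :
  (forall A : set Y, measurable A -> mu A = pushforward (P \x Q)%E polar A) ->
  (\int[mu]_x (dotv (grad f x) (grad f x))%:E =
     radial_energy + tangential_energy)%E.
Proof.
move=> muE.
have mG : measurable_fun setT
    (fun x : Y => (dotv (grad f x) (grad f x))%:E).
  apply/measurable_EFinP; apply: continuous_measurable_Rn;
    apply: dotv_continuous => i.
  rewrite (_ : (fun x => _) = partial i f); last by apply/funext => x;
    rewrite mxE.
  exact: (smooth_continuous (smooth_partial i sf)).
rewrite (ge0_integral_polar muE mG); last first.
  move=> x; rewrite lee_fin; exact: dotv_ge0.
have mS := @measurable_sphere R n.
rewrite -(integral_carried mS Q0); last first.
  apply: (measurable_fun_fubini_tonelli_G
    (fun z : X * Y => (dotv (grad f (polar z)) (grad f (polar z)))%:E)).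
    by apply: (measurableT_comp mG); exact: measurable_polar.
  move=> x; rewrite lee_fin; exact: dotv_ge0.
have mr := measurable_fun_fubini_tonelli_G (m1 := P) _ malong_sqr
  (fun z => ltac:(rewrite lee_fin; exact: sqr_ge0)).
have mt := measurable_fun_fubini_tonelli_G (m1 := P) _ mtangent_sqr
  (fun z => ltac:(rewrite lee_fin; apply: sumr_ge0 => ? _; exact: sqr_ge0)).
rewrite /radial_energy /tangential_energy.
rewrite -(integral_carried mS Q0 mr) -(integral_carried mS Q0 mt).
rewrite -ge0_integralD//; last 4 first.
- by move=> y _; apply: integral_ge0 => r _; rewrite lee_fin sqr_ge0.
- exact: measurable_funTS mr.
- move=> y _; apply: integral_ge0 => r _; rewrite lee_fin.
  by apply: sumr_ge0 => i _; exact: sqr_ge0.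
- exact: measurable_funTS mt.
apply: eq_integral => y /[!inE] yS.
rewrite -ge0_integralD//; last 4 first.
- by move=> r _; rewrite lee_fin sqr_ge0.
- exact: (measurable_fun_pair1 y malong_sqr).
- by move=> r _; rewrite lee_fin; apply: sumr_ge0 => i _; exact: sqr_ge0.
- exact: (measurable_fun_pair1 y mtangent_sqr).
apply: eq_integral => r _; rewrite -EFinD; congr EFin.
exact: dotv_grad_split.
Qed.

(** The one-dimensional inequality holds along every ray with the same
    constants, so it can be integrated over the directions. *)
Lemma radial_part (b : R -> \bar R) (s : R) : 0 < s -> (0 <= b s)%E ->
  weak_poincare P Rplus smooth_line (fun g r => derive1 g r ^+ 2) b ->
  ((\int[Q]_y Rvariance P (fun r => fp (r, y)))%:E <=
     b s * radial_energy + (s * o ^+ 2)%:E)%E.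
Proof.
move=> s0 bs0 wp.
have mp : measurable (Rplus : set X) by exact: measurable_itv.
have Rp0 : (Rplus : set X) !=set0 by exists 0; rewrite /Rplus /= in_itv/= lexx.
have pointwise (y : Y) : ((Rvariance P (fun r => fp (r, y)))%:E <=
    b s * \int[P]_r (along (y : 'rV[R]_n) f (polar (r, y)) ^+ 2)%:E +
    (s * o ^+ 2)%:E)%E.
  have := @weak_poincare_bounded _ _ _ P Rplus _ _ mp Rp0 P0 b
    (ray f y) M o s wp (@smooth_ray _ _ f y sf) s0 (measurable_section mfp y)
    (fun r => fM _) (fun _ _ _ _ => fo _ _).
  rewrite derive1_ray// integral_carried//.
  exact: (measurable_fun_pair1 y malong_sqr).
have mr := measurable_fun_fubini_tonelli_G (m1 := P) _ malong_sqr
  (fun z => ltac:(rewrite lee_fin; exact: sqr_ge0)).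
have mv := measurable_Rvariance_section P Q mfp fpM.
have v0 y : 0 <= Rvariance P (fun r => fp (r, y)).
  by apply: (@Rvariance_ge0 _ _ _ P _ M) => //;
    exact: (measurable_section mfp y).
have so0 : 0 <= s * o ^+ 2 by rewrite mulr_ge0 ?sqr_ge0// ltW.
have E0 (y : Y) : (0 <= \int[P]_r (along (y : 'rV[R]_n) f (polar (r, y)) ^+
  2)%:E)%E.
  by apply: integral_ge0 => r _; rewrite lee_fin sqr_ge0.
rewrite fineK; last first.
  by apply: integrable_fin_num => //; exact: (integrable_Rvariance_section P Q
    mfp fpM).
apply: (@le_trans _ _ (\int[Q]_y (b s * \int[P]_r (along (y : 'rV[R]_n) f
  (polar (r, y)) ^+ 2)%:E +
    (s * o ^+ 2)%:E))%E).
  apply: ge0_le_integral => //.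
  - by move=> y _; rewrite lee_fin.
  - exact/measurable_EFinP.
  - by apply: emeasurable_funD => //; exact: measurable_funeM.
rewrite ge0_integralD//; last 2 first.
- by move=> y _; rewrite mule_ge0.
- exact: measurable_funeM.
rewrite ge0_integralZl// integral_cst//= probability_setT mule1.
exact: lexx.
Qed.

(** Cauchy-Schwarz is applied to each coordinate of the tangential gradient of
    the truncated average, which is itself an average carrying a factor [r]. *)
Lemma truncated_energy (k : R) (y : Y) :
  ((dotv (sphere_grad (radial_average P k 0 f) y)
         (sphere_grad (radial_average P k 0 f) y))%:E <=
    second_moment P *
    \int[P]_r (\sum_i along (tangent (y : 'rV[R]_n) i) f (polar (r, y)) ^+
      2)%:E)%E.
Proof.
rewrite sphere_grad_tangent.
have cc (v : 'rV[R]_n) : continuous (along v f).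
  exact: (smooth_continuous (smooth_along v sf)).
have mK : measurable (`[0, k]%classic : set X) by exact: measurable_itv.
pose w i (r : X) := along (tangent (y : 'rV[R]_n) i) f (r *: (y : 'rV[R]_n)).
have mw i : measurable_fun setT (w i).
  by apply: continuous_measurable_fun; apply: continuous_along; exact: cc.
have mw2 i : measurable_fun setT (fun r => (w i r ^+ 2)%:E).
  by apply/measurable_EFinP; exact: measurable_funX.
have w20 i (r : X) : (0 <= (w i r ^+ 2)%:E)%E by rewrite lee_fin sqr_ge0.
have mid : measurable_fun setT (fun r : X => (r ^+ 2)%:E).
  by apply/measurable_EFinP; exact: exprn_measurable.
have E : (\int[P]_r (\sum_i w i r ^+ 2)%:E = \sum_i \int[P]_r (w i r ^+
  2)%:E)%E.
  by rewrite -ge0_integral_sum//; apply: eq_integral => r _; rewrite sumEFin.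
rewrite [X in (_ * X)%E]E ge0_sume_distrr; last first.
  by move=> i _; apply: integral_ge0 => r _; exact: w20.
rewrite -sumEFin; apply: lee_sum => i _.
rewrite (along_radial_average _ _ _ _ _ sf)//.
have [A A0 HA] := continuous_bounded_along (y : 'rV[R]_n) k (cc (tangent y i)).
have := @Rintegral_cauchy_schwarz _ _ _ P `[0, k]%classic id (w i) `|k| A mK.
move=> /(_ (@measurable_id _ _ _) (measurable_funTS (mw i))).
have H1 (r : X) : `[0, k]%classic r -> `|id r| <= `|k|.
  by rewrite /= in_itv/= => /andP[r0 rk]; rewrite !ger0_norm// (le_trans r0).
have H2 (r : X) : `[0, k]%classic r -> `|w i r| <= A.
  by rewrite /= in_itv/= => rk; exact: HA.
move=> /(_ H1 H2) cs.
have R1 : P.-integrable `[0, k]%classic (EFin \o (fun r : X => id r ^+ 2)).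
  apply: (@bounded_integrable _ _ _ P _ _ (`|k| ^+ 2)) => //.
  by move=> r /H1 rk; rewrite normrX lerXn2r ?nnegrE.
have R2 : P.-integrable `[0, k]%classic (EFin \o (fun r : X => w i r ^+ 2)).
  apply: (@bounded_integrable _ _ _ P _ _ (A ^+ 2)) => //.
    exact: (measurable_funX _ (measurable_funTS (mw i))).
  by move=> r /H2 rk; rewrite normrX lerXn2r ?nnegrE.
apply: (@le_trans _ _ ((\int[P]_(r in `[0, k]%classic) (r ^+ 2))%:E *
    (\int[P]_(r in `[0, k]%classic) (w i r ^+ 2))%:E)%E).
  by rewrite -EFinM lee_fin; apply: le_trans cs; rewrite /radial_average.
rewrite !fineK; [|exact: (integrable_fin_num mK R2)|exact: (integrable_fin_num
  mK R1)].
apply: lee_pmul.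
- by apply: integral_ge0 => r _; rewrite lee_fin sqr_ge0.
- by apply: integral_ge0 => r _; exact: w20.
- apply: ge0_subset_integral => //.
  + exact: measurable_itv.
  + exact: measurable_funTS mid.
  + by move=> r _; rewrite lee_fin sqr_ge0.
  + by move=> r /=; rewrite /Rplus /= !in_itv/= andbT => /andP[].
- by apply: ge0_subset_integral => //; exact: mw2.
Qed.

Lemma truncation_error (k : R) (y : Y) :
  `|F y - radial_average P k 0 f y| <= M * fine (P (~` `[0, k]%classic)).
Proof.
have mK : measurable (`[0, k]%classic : set X) by exact: measurable_itv.
have mf := measurable_section mfp y.
have IT := integrable_section P mfp fpM y.
have -> : F y = \int[P]_(r in `[0, k]%classic `|` ~` `[0, k]%classic) fp (r, y).
  by rewrite setUv.
rewrite Rintegral_setU//; last 3 first.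
- exact: measurableC.
- by rewrite setUv.
- by apply/disj_setPS => r [].
have -> : radial_average P k 0 f y = \int[P]_(r in `[0, k]%classic) fp (r, y).
  by apply: eq_Rintegral => r _; rewrite expr0 mul1r.
rewrite addrAC subrr add0r; apply: Rintegral_bound_measure.
- exact: measurableC.
- exact: measurable_funTS.
- by move=> r _; exact: fM.
Qed.

Lemma truncation_bound (k : R) (y : Y) : `|radial_average P k 0 f y| <= M.
Proof.
apply: Rintegral_bound.
- exact: measurable_itv.
- by apply: measurable_moment_along; exact: (smooth_continuous sf).
- exact: le_trans (fM 0).
- by move=> r _; rewrite expr0 mul1r.
Qed.

Lemma truncation_oscillation (k : R) (x y : Y) :
  radial_average P k 0 f x - radial_average P k 0 f y <= o.
Proof.
have mK : measurable (`[0, k]%classic : set X) by exact: measurable_itv.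
have I z := integrable_moment_along P k 0 z (smooth_continuous sf).
rewrite /radial_average -RintegralB//.
apply: le_trans (ler_norm _) _; apply: Rintegral_bound => //.
- by apply: measurable_funB; apply: measurable_moment_along;
  exact: (smooth_continuous sf).
- by have := fo 0 0; rewrite subrr.
- move=> r _; rewrite !expr0 !mul1r ler_norml fo andbT.
  by rewrite lerNl opprB fo.
Qed.

(** The inequality for [Q] is applied to the truncated radial mean, whose energy
    is finite, so the constant can be taken to be the infimum. *)
Lemma truncated_angular_part (k s : R) : 0 < s ->
  wp_admissible Q sphere smooth_sphere
    (fun g x => dotv (sphere_grad g x) (sphere_grad g x)) !=set0 ->
  ((Rvariance Q (radial_average P k 0 f))%:E <=
    betaWP_sphere Q s * (second_moment P * tangential_energy) + (s * o ^+
      2)%:E)%E.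
Proof.
move=> s0 A0; set Fk := radial_average P k 0 f.
have sFk : smooth_on setT Fk by exact: smooth_radial_average.
have mS := @measurable_sphere R n.
have S0 : (sphere : set Y) !=set0.
  apply/set0P/eqP => SE; move: Q0; rewrite SE setC0 probability_setT.
  by move/eqP; rewrite onee_eq0.
have fin := sphere_energy_fin_num Q sFk.
have e0 (y : Y) : 0 <= dotv (sphere_grad Fk y) (sphere_grad Fk y).
  exact: dotv_ge0.
have mt := measurable_fun_fubini_tonelli_G (m1 := P) _ mtangent_sqr
  (fun z => ltac:(rewrite lee_fin; apply: sumr_ge0 => ? _; exact: sqr_ge0)).
have I0 (y : Y) : (0 <= \int[P]_r (\sum_i along (tangent (y : 'rV[R]_n) i) f
  (polar (r, y)) ^+ 2)%:E)%E.
  apply: integral_ge0 => r _; rewrite lee_fin.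
  by apply: sumr_ge0 => i _; exact: sqr_ge0.
have m20 : (0 <= second_moment P)%E.
  by apply: integral_ge0 => r _; rewrite lee_fin sqr_ge0.
have mE : measurable_fun setT (fun y : Y =>
  (dotv (sphere_grad Fk y) (sphere_grad Fk y))%:E).
  by apply/measurable_EFinP; exact: (continuous_measurable_Rn
    (continuous_sphere_energy sFk)).
apply: (@le_trans _ _ (betaWP_sphere Q s * \int[Q]_(x in sphere)
    (dotv (sphere_grad Fk x) (sphere_grad Fk x))%:E + (s * o ^+ 2)%:E)%E).
  rewrite -(fineK fin); apply: le_ereal_inf_mulD.
  - by have [b bA] := A0; exists (b s), b.
  - by rewrite fine_ge0// integral_ge0// => y _; rewrite lee_fin.
  - move=> _ [b [_ _ wp] <-]; rewrite fineK//.
    apply: (weak_poincare_bounded (M := M) mS S0 Q0 wp).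
    + by exists setT; split=> //; exact: openT.
    + by [].
    + exact: (continuous_measurable_Rn (smooth_continuous sFk)).
    + exact: truncation_bound.
    + by move=> x y _ _; exact: truncation_oscillation.
rewrite leeD2r// lee_wpmul2l//; first exact: betaWP_ge0.
rewrite integral_carried// /tangential_energy -ge0_integralZl//.
apply: ge0_le_integral => //.
- by move=> y _; rewrite lee_fin.
- exact: measurable_funeM.
- by move=> y _; exact: truncated_energy.
Qed.

(** The bound on the truncated means does not depend on [k], and their variance
    is as close as desired to the variance of the full radial mean. *)
Lemma angular_part (s : R) : 0 < s ->
  wp_admissible Q sphere smooth_sphere
    (fun g x => dotv (sphere_grad g x) (sphere_grad g x)) !=set0 ->
  ((Rvariance Q (fun y => \int[P]_r fp (r, y)))%:E <=
    betaWP_sphere Q s * (second_moment P * tangential_energy) + (s * o ^+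
      2)%:E)%E.
Proof.
move=> s0 A0; apply/lee_addgt0Pr => e e0.
have M0 : 0 <= M by apply: le_trans (fM 0).
pose c := 4 * M * M + 1.
have c0 : 0 < c by rewrite ltr_wpDl// !mulr_ge0.
(* c bounds the change of the variance relative to the mass of the tail; the
   extra 1 only makes it positive. *)
have [k Pk] := radial_tail_small P0 (divr_gt0 e0 c0).
have step : Rvariance Q F <= Rvariance Q (radial_average P k 0 f) + e.
  apply: le_trans (Rvariance_le_uniform (M := M) (e :=
    M * fine (P (~` `[0, k]%classic))) _ _ _ _ _ _) _.
  - exact: (measurable_Rintegral_section P Q mfp fpM).
  - apply: continuous_measurable_Rn.
    exact: (@radial_average_continuous _ _ P k 0 f (smooth_continuous sf)).
  - exact: (Rintegral_section_bound P mfp fpM).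
  - exact: truncation_bound.
  - exact: truncation_error.
  rewrite lerD2l mulrA; move: Pk; rewrite ltr_pdivlMr// => /ltW;
    apply: le_trans.
  by rewrite mulrC ler_wpM2l ?lerDl// fine_ge0.
apply: (@le_trans _ _ ((Rvariance Q (radial_average P k 0 f))%:E + e%:E)%E).
  by rewrite -EFinD lee_fin.
by rewrite leeD2r//; exact: truncated_angular_part.
Qed.

End TwoParts.

(** * The bound for nearly radial measures *)

(** The admissible function for [mu] is built from an arbitrary admissible
    function [b] for the radial measure, but from the optimal one for the
    angular measure. *)
Lemma wp_admissible_nearly_radial (R : realType) (n : nat)
    (mu : probability (Rn R n) R)
    (P : probability (measurableTypeR R) R) (Q : probability (Rn R n) R)
    (b : R -> \bar R) :
  P (~` Rplus) = 0%E -> Q (~` sphere) = 0%E ->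
  (forall A : set (Rn R n), measurable A ->
     mu A = pushforward (P \x Q)%E polar A) ->
  wp_admissible P Rplus smooth_line (fun g r => derive1 g r ^+ 2) b ->
  wp_admissible Q sphere smooth_sphere
    (fun g x => dotv (sphere_grad g x) (sphere_grad g x)) !=set0 ->
  wp_admissible mu setT (smooth_on setT)
    (fun g x => dotv (grad g x) (grad g x))
    (fun s => maxe (b (s / 2)%R) (second_moment P * betaWP_sphere Q (s /
      2)%R)%E).
Proof.
move=> P0 Q0 muE [b0 bni wp] A0; split=> [s s0|s t s0 st|s f s0 sf].
- by rewrite le_max b0// divr_gt0.
- have s20 : 0 < s / 2 by rewrite divr_gt0.
  have st2 : s / 2 <= t / 2 by rewrite ler_pM2r// invr_gt0.
  rewrite ge_max !le_max bni//= orbC lee_wpmul2l ?betaWP_nonincreasing//.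
  by apply: integral_ge0 => r _; rewrite lee_fin sqr_ge0.
have s20 : 0 < s / 2 by rewrite divr_gt0.
have G0 : (0 <= \int[mu]_x (dotv (grad f x) (grad f x))%:E)%E.
  by apply: integral_ge0 => x _; rewrite lee_fin dotv_ge0.
have B0 : (0 <= maxe (b (s / 2)%R) (second_moment P * betaWP_sphere Q (s /
  2)%R))%E.
  by rewrite le_max b0.
have T0 : [set: Rn R n] !=set0 by exists (0 : 'rV[R]_n).
(* For unbounded f the right-hand side is infinite. *)
have [OE|[a [M [OE fo fM]]]] := Osc_dichotomy f T0.
  rewrite OE (_ : +oo ^+ 2 = +oo)%E; last by rewrite expe2 mulyy.
  by rewrite gt0_muley ?lte_fin// addey ?leey// gt_eqF// (lt_le_trans _
    (mule_ge0 B0 G0))// ltNy0.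
have fo' (x y : 'rV[R]_n) : f x - f y <= a by exact: fo.
have fM' (x : 'rV[R]_n) : `|f x| <= M by exact: fM.
have fM2 (x : Rn R n) : `|f x ^+ 2| <= M ^+ 2.
  exact: (@bounded_sqr _ (Rn R n) R f M).
have mf := continuous_measurable_Rn (smooth_continuous sf).
rewrite OE (bounded_integral_polar muE mf fM').
rewrite (bounded_integral_polar muE (measurable_funX 2 mf) fM2).
have mfp : measurable_fun setT (fun z : measurableTypeR R * Rn R n =>
  f (polar z)).
  by apply: (measurableT_comp mf); exact: measurable_polar.
rewrite -!EFin_expe -EFinB.
rewrite (total_variance P Q mfp (fun z => fM' (polar z))).
rewrite (energy_split Q0 sf muE) EFinD.
have Hr := radial_part Q P0 sf fM' fo' s20 (b0 _ s20) wp.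
have Ha := angular_part P0 Q0 sf fM' fo' s20 A0.
apply: le_trans (leeD Hr Ha) _.
have Er := radial_energy_ge0 P Q f; have Et := tangential_energy_ge0 P Q f.
move: Er Et; set er := radial_energy _ _ _; set et := tangential_energy _ _ _.
clearbody er et => Er Et; rewrite ge0_muleDr// addeACA -EFinD -mulrDl -splitr
  -EFinM leeD2r//.
apply: leeD; first by rewrite lee_wpmul2r// le_max lexx.
by rewrite muleA (muleC (betaWP_sphere Q _)) lee_wpmul2r// le_max lexx orbT.
Qed.

Theorem theorem3p2 (R : realType) (n : nat) (hn : (2 <= n)%N)
    (sigma : probability (Rn R n) R) (hsigma : uniform_sphere sigma)
    (Vr : R -> R) (Va : 'rV[R]_n -> R)
    (mu : probability (Rn R n) R)
    (mur : probability (measurableTypeR R) R)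
    (mua : probability (Rn R n) R)
    (hmu : nearly_radial sigma Vr Va mu mur mua)
    (t : R) (ht : 0 < t) :
  (betaWP_Rn mu t <=
     maxe (betaWP_radial mur (t / 2))
          (second_moment mur * betaWP_sphere mua (t / 2)))%E.
Proof.
have [dr da muE] := hmu.
have P0 : mur (~` Rplus) = 0%E.
  by apply: density_carried dr; exact: measurable_itv.
have Q0 := density_carried (@measurable_sphere R n) da.
set A := wp_admissible mua sphere smooth_sphere
    (fun g x => dotv (sphere_grad g x) (sphere_grad g x)).
have [A0|] := pselect (A !=set0); last first.
  move=> /set0P/negP; rewrite negbK => /eqP AE.
  suff -> : betaWP_sphere mua (t / 2) = +oo%E.
    by rewrite gt0_muley ?(second_moment_gt0 dr)// le_max leey orbT.
  by rewrite /betaWP_sphere /betaWP -/A AE image_set0 ereal_inf0.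
set c := (second_moment mur * _)%E.
have [//|lt] := leP (betaWP_Rn mu t) (maxe (betaWP_radial mur (t / 2)) c).
have bound b : wp_admissible mur Rplus smooth_line (fun g r =>
  derive1 g r ^+ 2) b ->
    (betaWP_Rn mu t <= maxe (b (t / 2)%R) c)%E.
  move=> bA; apply: ereal_inf_lbound.
  by exists (fun s => maxe (b (s / 2)%R) (second_moment mur * betaWP_sphere
    mua (s / 2)%R)%E) => //; exact: wp_admissible_nearly_radial.
(* As the angular term alone is too small, every b (t / 2) exceeds it. *)
suff : (betaWP_Rn mu t <= betaWP_radial mur (t / 2))%E.
  by rewrite leNgt (le_lt_trans _ lt)// le_max lexx.
apply: le_ereal_inf_tmp => _ [b /bound + <-]; rewrite le_max => /orP[//|].
by rewrite leNgt (le_lt_trans _ lt)// le_max lexx orbT.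
Qed.
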